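(* Let $X\subseteq\mathbb{R}^n$ be nonempty, closed, convex and bounded, and let $F:X\to\mathbb{R}^n$ be monotone on $X$ (i.e. $\langle F(x)-F(y),x-y\rangle\ge 0$ for all $x,y\in X$) and satisfy, for some $\nu\in[0,\infty)$, $L_\nu>0$, $M_\nu\ge 0$, the growth condition $\|F(x)-F(y)\|_*\le L_\nu\|x-y\|^\nu+M_\nu$ for all $x,y\in X$. Let $D>0$ satisfy $D\ge\max_{x,z\in X}B_\psi(z,x)$ and set $$\bar D=\begin{cases}\dfrac{3\cdot2^\nu L_\nu^2D^\nu}{\alpha^{1+\nu}}+\dfrac{6M_\nu^2}{\alpha}&\text{when }\nu>0,\\[2mm]\dfrac{(L_0+M_0)^2}{2\alpha}&\text{when }\nu=0.\end{cases}$$ Then for the iterates of the deterministic Popov mirror-prox algorithm: (i) With known total number of iterations $T\ge0$ and constant $c>0$, $$G\left(\frac1{T+1}\sum_{t=0}^Ty_{t+1}\right)\le\frac{D+c^2\bar D}{c\sqrt{T+1}}\quad\text{when }\gamma_t=\gamma=\tfrac{c}{\sqrt{T+1}}\text{ for all }t=0,\dots,T,$$ $$G\left(\frac{\sum_{t=\lceil T/2\rceil}^T\gamma_ty_{t+1}}{\sum_{t=\lceil T/2\rceil}^T\gamma_t}\right)\le\frac{2D+2\ln(4)\,c^2\bar D}{c\sqrt{T+1}}\quad\text{when }\gamma_t=\tfrac{c}{\sqrt{t+1}}\text{ for }t=0,\dots,T.$$ (ii) With $\gamma_t=\frac{c}{(t+1)^a}$, where $c>0$ and $0<a<1$, for all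 $T\ge0$, $$G\left(\frac{\sum_{t=0}^T\gamma_ty_{t+1}}{\sum_{t=0}^T\gamma_t}\right)\le\begin{cases}\dfrac{D}{c(T+1)^{1-a}}+\dfrac{\bar Dc}{(1-2a)(T+1)^a}&\text{when }0<a<\frac12,\\[2mm]\dfrac{D}{c(T+1)^{1-a}}+\dfrac{\bar Dc(1+\ln(T+1))}{(T+1)^{1-a}}&\text{when }a=\frac12,\\[2mm]\dfrac{D}{c(T+1)^{1-a}}+\dfrac{2a\bar Dc}{(2a-1)(T+1)^{1-a}}&\text{when }\frac12<a<1.\end{cases}$$ (iii) With $\gamma_t=\frac{c}{(t+1)^a}$, where $c>0$ and $0<a<1$, for all $T\ge1$, $$G\left(\frac{\sum_{t=0}^T\gamma_t^{-1}y_{t+1}}{\sum_{t=0}^T\gamma_t^{-1}}\right)\le\frac{4^a(1+a)D}{cT^{1-a}}+\frac{2\bar Dc(1+a)}{T^a}.$$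
   Context: $\|\cdot\|$ is an arbitrary norm on $\mathbb{R}^n$, $\langle\cdot,\cdot\rangle$ the standard inner product, and $\|x\|_*=\max_{\|z\|\le1}\langle x,z\rangle$ the conjugate norm. For $\nu=0$ the term $\|x-y\|^0$ is read as $1$, and $L_0,M_0$ denote $L_\nu,M_\nu$ at $\nu=0$. The function $\psi:X\to\mathbb{R}$ is continuously differentiable and $\alpha$-strongly convex for some $\alpha>0$: $\psi(z)\ge\psi(x)+\langle\nabla\psi(x),z-x\rangle+\frac{\alpha}{2}\|z-x\|^2$ for all $x,z\in X$. Its Bregman divergence is $B_\psi(z,x)=\psi(z)-\psi(x)-\langle\nabla\psi(x),z-x\rangle$, $x,z\in X$. Deterministic Popov mirror-prox algorithm: $x_0=y_0\in X$ arbitrary, and for $t\ge0$ with step size $\gamma_t>0$, $$y_{t+1}=\operatorname*{argmin}_{z\in X}\left[\langle\gamma_tF(y_t)-\nabla\psi(x_t),z\rangle+\psi(z)\right],\qquad x_{t+1}=\operatorname*{argmin}_{z\in X}\left[\langle\gamma_tF(y_{t+1})-\nabla\psi(x_t),z\rangle+\psi(z)\right].$$ Dual gap function: $G(x)=\sup_{z\in X}\langle F(z),x-z\rangle$ for $x\in X$. *)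

(* Defs.v *)
From HB Require Import structures.
From mathcomp Require Export all_boot all_order all_algebra.
From mathcomp Require Export all_classical all_reals all_analysis.
Export Order.TTheory GRing.Theory Num.Theory numFieldNormedType.Exports.

Set Implicit Arguments.
Unset Strict Implicit.
Unset Printing Implicit Defensive.

Local Open Scope classical_set_scope.
Local Open Scope ring_scope.

(* Functions defined on the feasible set X only are represented by total      *)
(* functions on 'rV[R]_n; all the predicates below look at their values on X  *)
(* and nowhere else.                                                          *)
(* The topology and the boundedness of subsets of 'rV[R]_n are the library's  *)
(* (sup norm); all norms on R^n being equivalent, they are also those of the  *)
(* arbitrary norm N.                                                          *)

Section Defs.
Variables (R : realType) (n : nat).
Implicit Types (X : set 'rV[R]_n) (F g : 'rV[R]_n -> 'rV[R]_n).
Implicit Types (N psi : 'rV[R]_n -> R) (u v x y z : 'rV[R]_n).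

Definition dotp u v : R := \sum_(i < n) u ord0 i * v ord0 i.

Record is_norm N : Prop := IsNorm {
  is_norm_triangle : forall u v, N (u + v) <= N u + N v;
  is_norm_scale : forall (a : R) u, N (a *: u) = `|a| * N u;
  is_norm_eq0 : forall u, N u = 0 -> u = 0 }.

(* The set is nonempty, and bounded above since the unit ball of N is         *)
(* bounded, so that this real supremum is never a default value; it is        *)
(* attained.                                                                  *)
Definition conj_norm N u : R := sup [set dotp u z | z in [set z | N z <= 1]].

Definition monotone_on X F : Prop :=
  forall x y, X x -> X y -> 0 <= dotp (F x - F y) (x - y).

(* For nu = 0 the power is 1, also when x = y (powRr0). *)
Definition growth_condition X N F (nu L M : R) : Prop :=
  forall x y, X x -> X y ->
    conj_norm N (F x - F y) <= L * (N (x - y)) `^ nu + M.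

(* g is a gradient of psi on X, relative to X: no value of psi outside X is   *)
(* involved, and X may have an empty interior. When psi is C^1 on an open     *)
(* neighbourhood of X, its usual gradient qualifies.                          *)
Definition is_gradient_on X psi g : Prop :=
  forall x, X x ->
    (fun z => psi z - psi x - dotp (g x) (z - x))
      =o_ (within X (nbhs x)) (fun z => z - x).

Definition C1_on X psi g : Prop :=
  is_gradient_on X psi g /\ {within X, continuous g}.

Definition strongly_convex_on X N psi g (alpha : R) : Prop :=
  forall x z, X x -> X z ->
    psi x + dotp (g x) (z - x) + alpha / 2 * N (z - x) ^+ 2 <= psi z.

Definition bregman psi g z x : R := psi z - psi x - dotp (g x) (z - x).

Definition is_argmin X (f : 'rV[R]_n -> R) z : Prop :=
  X z /\ forall w, X w -> f z <= f w.

(* The minimized functions are strongly convex on X, hence the minimizers are *)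
(* unique.                                                                    *)
Definition popov_mirror_prox X F psi g (gamma : nat -> R)
    (x y : nat -> 'rV[R]_n) : Prop :=
  [/\ X (x 0%N), y 0%N = x 0%N &
   forall t : nat,
   [/\ 0 < gamma t,
       is_argmin X
         (fun z => dotp (gamma t *: F (y t) - g (x t)) z + psi z) (y t.+1) &
       is_argmin X
         (fun z => dotp (gamma t *: F (y t.+1) - g (x t)) z + psi z)
         (x t.+1)]].

Definition dual_gap X F x : \bar R :=
  ereal_sup [set (dotp (F z) (x - z))%:E | z in X].

Definition Dbar (nu L M alpha D : R) : R :=
  if nu == 0 then (L + M) ^+ 2 / (2 * alpha)
  else 3 * 2 `^ nu * L ^+ 2 * D `^ nu / alpha `^ (1 + nu)
       + 6 * M ^+ 2 / alpha.

End Defs.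

(* Main.v *)
Require Import Defs.
From mathcomp Require Import ring lra zify.

(* Adding the first-order optimality conditions of the two proximal steps     *)
(* (three-point form) and using monotonicity of F gives, for every z in X,    *)
(*   gamma_t <F z, y_{t+1} - z>                                               *)
(*     <= B(z, x_t) - B(z, x_{t+1}) + gamma_t^2 Dbar,                         *)
(* where |x - y| <= sqrt (2 D / alpha) on X bounds the growth of F. Weighting *)
(* by a nondecreasing r_t and summing by parts, the Bregman terms contribute  *)
(* at most r_T D. The choices r_t = 1 and r_t = gamma_t^-2 (r_t = gamma_t^-1  *)
(* for constant steps) and elementary bounds on power sums conclude.          *)

(** Each of the two proximal steps is tested against a competitor: the step to [x_{t+1}] against an
    arbitrary [z] in [X], the extrapolation step to [y_{t+1}] against [x_{t+1}]. In the sum the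
    divergence from [x_t] to [x_{t+1}] cancels, and what remains, apart from the telescoping terms,
    is the error [<F y_{t+1} - F y_t, y_{t+1} - x_{t+1}>]. Duality of norms and strong convexity of
    [psi] absorb it at the price of a multiple of [gamma_t^2] ([popov_step]). The diameter bound
    coming from [D] turns that multiple into [Dbar] ([growth_sqr_le_Dbar]).

    For fixed [z] the quantity [<F z, y - z>] is affine in [y], so its value at a weighted average
    of the [y_{t+1}] is the average of its values. Hence [weighted_gap_le] reduces every rate to one
    scalar inequality between the weights, the sum of [r_t gamma_t^2] and the claimed bound. The
    proof of [corollary1] checks it for each choice of steps and weights. *)

Set Implicit Arguments.
Unset Strict Implicit.
Unset Printing Implicit Defensive.

Local Open Scope classical_set_scope.
Local Open Scope ring_scope.

(** * Bilinearity and crude bounds for the inner product *)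

Section Dotp.
Variables (R : realType) (n : nat).
Implicit Types (u v w : 'rV[R]_n) (a : R).

Lemma dotpDl u v w : dotp (u + v) w = dotp u w + dotp v w.
Proof.
by rewrite /dotp -big_split; apply: eq_bigr => i _; rewrite mxE mulrDl.
Qed.

Lemma dotpZl a u w : dotp (a *: u) w = a * dotp u w.
Proof.
by rewrite /dotp mulr_sumr; apply: eq_bigr => i _; rewrite mxE mulrA.
Qed.

Lemma dotpC u v : dotp u v = dotp v u.
Proof. by apply: eq_bigr => i _; rewrite mulrC. Qed.

Lemma dotpDr u v w : dotp w (u + v) = dotp w u + dotp w v.
Proof. by rewrite dotpC dotpDl !(dotpC _ w). Qed.

Lemma dotpZr a u w : dotp w (a *: u) = a * dotp w u.
Proof. by rewrite dotpC dotpZl (dotpC _ w). Qed.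

Lemma dotpBl u v w : dotp (u - v) w = dotp u w - dotp v w.
Proof. by rewrite dotpDl -scaleN1r dotpZl mulN1r. Qed.

Lemma dotpBr u v w : dotp w (u - v) = dotp w u - dotp w v.
Proof. by rewrite dotpC dotpBl !(dotpC _ w). Qed.

Lemma dotp_sumr (I : Type) (r : seq I) (G : I -> 'rV[R]_n) w :
  dotp w (\sum_(i <- r) G i) = \sum_(i <- r) dotp w (G i).
Proof.
elim/big_rec2 : _ => [|i b c _ <-]; last by rewrite dotpDr.
by apply: big1 => i _; rewrite mxE mulr0.
Qed.

Lemma ler_entry_norm u i : `|u ord0 i| <= `|u|.
Proof.
rewrite [leRHS]mx_normrE.
exact: (le_bigmax _ (fun ij => `|u ij.1 ij.2|) (ord0, i)).
Qed.

Lemma ler_dotp_norm u v : `|dotp u v| <= (\sum_(i < n) `|u ord0 i|) * `|v|.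
Proof.
rewrite mulr_suml; apply: le_trans (ler_norm_sum _ _ _) _.
by apply: ler_sum => i _; rewrite normrM ler_wpM2l // ler_entry_norm.
Qed.

End Dotp.

(** * Equivalence of norms on R^n and the duality inequality *)

Section ConjNorm.
Variables (R : realType) (n : nat) (N : 'rV[R]_n -> R).
Hypothesis N_norm : is_norm N.
Implicit Types u v : 'rV[R]_n.

Lemma is_norm0 : N 0 = 0.
Proof. by rewrite -(scale0r (0 : 'rV[R]_n)) is_norm_scale // normr0 mul0r. Qed.

Lemma is_normN u : N (- u) = N u.
Proof. by rewrite -scaleN1r is_norm_scale // normrN1 mul1r. Qed.

Lemma is_norm_ge0 u : 0 <= N u.
Proof.
have := is_norm_triangle N_norm u (- u).
by rewrite subrr is_norm0 is_normN -mulr2n pmulrn_lge0.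
Qed.

Lemma is_norm_distC u v : N (u - v) = N (v - u).
Proof. by rewrite -is_normN opprB. Qed.

Lemma is_norm_sum (I : Type) (r : seq I) (G : I -> 'rV[R]_n) :
  N (\sum_(i <- r) G i) <= \sum_(i <- r) N (G i).
Proof.
elim/big_rec2 : _ => [|i b c _ h]; first by rewrite is_norm0.
by apply: le_trans (is_norm_triangle N_norm _ _) _; rewrite lerD2l.
Qed.

Lemma is_norm_upper_bound :
  exists2 C : R, 0 < C & forall u, N u <= C * `|u|.
Proof.
(* The summand 1 keeps the constant positive also when [n] is 0. *)
exists (1 + \sum_(i < n) N (delta_mx ord0 i)).
  by apply: ltr_pwDl => //; apply: sumr_ge0 => i _; exact: is_norm_ge0.
move=> u; rewrite {1}(row_sum_delta u).
apply: le_trans (is_norm_sum _ _) _.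
rewrite mulrDl mul1r ler_wpDl // mulr_suml.
apply: ler_sum => i _; rewrite is_norm_scale // mulrC.
by rewrite ler_wpM2l ?is_norm_ge0 // ler_entry_norm.
Qed.

(** By the triangle inequality and [is_norm_upper_bound], [N] is Lipschitz for the sup norm. *)
Lemma is_norm_continuous : continuous N.
Proof.
have [C C0 NC] := is_norm_upper_bound.
move=> u; apply/(@cvgrPdist_le _ _ _ _ (nbhs_filter u)) => e e0.
apply/(@nbhs_normP R 'rV[R]_n u (fun v => `|N u - N v| <= e)).
exists (e / C) => [|v /ltW h] /=; first exact: divr_gt0.
rewrite ler_pdivlMr // mulrC in h.
have h1 := is_norm_triangle N_norm (u - v) v.
have h2 := is_norm_triangle N_norm (v - u) u.
rewrite !subrK (is_norm_distC v u) in h1 h2.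
have h3 := NC (u - v).
by rewrite ler_norml; apply/andP; split; lra.
Qed.

(* The minimum of [N] over the unit sphere of the sup norm is positive. *)
Lemma is_norm_lower_bound :
  exists2 C : R, 0 < C & forall u, `|u| <= C * N u.
Proof.
pose S : set 'rV[R]_n := [set u | `|u| = 1].
(* The sphere is empty when [n] is 0; the extreme value theorem needs a point in it. *)
have [S0|/set0P S0] := eqVneq S set0.
  exists 1 => // u; have [->|u0] := eqVneq u 0.
    by rewrite normr0 is_norm0 mulr0.
  suff : S (`|u|^-1 *: u) by rewrite S0.
  by rewrite /S /= normrZ normfV normr_id mulVf // normr_eq0.
have cS : compact S.
  apply: bounded_closed_compact.
    by exists 1; split=> // r r1 u /= ->; exact: ltW.
  apply: (@closed_comp _ _ (fun u : 'rV[R]_n => `|u|) [set (1 : R)]) => //.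
  by move=> u _; exact: norm_continuous.
have [c /set_mem cS1 cmin] := EVT_min_rV S0 cS
  (continuous_subspaceT is_norm_continuous).
have Nc : 0 < N c.
  rewrite lt_neqAle is_norm_ge0 andbT eq_sym; apply/eqP.
  move=> /(is_norm_eq0 N_norm) c0.
  by move: cS1; rewrite /S /= c0 normr0 => /esym/eqP; rewrite oner_eq0.
exists (N c)^-1; first by rewrite invr_gt0.
move=> u; have [->|u0] := eqVneq u 0.
  by rewrite normr0 is_norm0 mulr0.
have u_gt0 : 0 < `|u| by rewrite normr_gt0.
have /cmin : `|u|^-1 *: u \in S.
  by apply/mem_set; rewrite /S /= normrZ normfV normr_id mulVf // gt_eqF.
rewrite is_norm_scale // normfV normr_id mulrC ler_pdivlMr // => h.
by rewrite [leRHS]mulrC ler_pdivlMr // mulrC.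
Qed.

(** Normalise [v] to a competitor in the supremum. The supremum is a genuine one because
    [is_norm_lower_bound] makes the unit ball of [N] bounded. *)
Lemma dotp_le_conj_norm u v : dotp u v <= conj_norm N u * N v.
Proof.
have [->|v0] := eqVneq v 0.
  by rewrite is_norm0 mulr0 -(scale0r (0 : 'rV[R]_n)) dotpZr mul0r.
have Nv : 0 < N v.
  rewrite lt_neqAle is_norm_ge0 andbT eq_sym.
  by apply: contra_neq v0 => /is_norm_eq0; exact.
have [C C0 NC] := is_norm_lower_bound.
rewrite -ler_pdivrMr // mulrC -dotpZr; apply: ub_le_sup; last first.
  exists ((N v)^-1 *: v) => //=.
  by rewrite is_norm_scale // gtr0_norm ?invr_gt0 // mulVf // gt_eqF.
exists ((\sum_(i < n) `|u ord0 i|) * C) => _ [z /= Nz <-].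
apply: le_trans (ler_norm _) _; apply: le_trans (ler_dotp_norm _ _) _.
rewrite ler_wpM2l ?sumr_ge0 //; apply: le_trans (NC z) _.
by rewrite ler_piMr // ltW.
Qed.

End ConjNorm.

(** * Bernoulli inequalities and bounds on power and harmonic sums *)

Section PowerSums.
Variable R : realType.
Implicit Types (x p a b : R) (k m : nat).

Lemma ln_le_subr1 x : 0 < x -> ln x <= x - 1.
Proof.
by move=> x0; rewrite -{1}(subrK 1 x) addrC le_ln1Dx // ltrBrDr addNr.
Qed.

(* With m := 1 + p (x - 1), bound ln (x / m) and ln (1 / m) by the tangent. *)
Lemma powR_le_bernoulli x p : 0 <= x -> 0 < p -> p <= 1 ->
  x `^ p <= 1 + p * (x - 1).
Proof.
move=> x0 p0 p1; have [->|x_neq0] := eqVneq x 0.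
  by rewrite powR0 ?gt_eqF //; lra.
have {x_neq0}x0 : 0 < x by rewrite lt_neqAle eq_sym x_neq0.
pose m := 1 + p * (x - 1).
have m0 : 0 < m.
  by rewrite /m; have := mulr_gt0 p0 x0; lra.
have h1 := ln_le_subr1 (divr_gt0 x0 m0).
have h2 := ln_le_subr1 (divr_gt0 ltr01 m0).
rewrite !ln_div ?posrE // ln1 in h1 h2.
rewrite -/m -ler_ln ?posrE ?powR_gt0 // ln_powR.
have h1' := ler_wpM2l (ltW p0) h1.
have h2' : (1 - p) * (0 - ln m) <= (1 - p) * (1 / m - 1).
  by apply: ler_wpM2l => //; rewrite subr_ge0.
have e : p * (x / m - 1) + (1 - p) * (1 / m - 1) = 0.
  by rewrite /m; field; rewrite -/m gt_eqF.
lra.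
Qed.

(** When the left side is positive, apply the concave case to it with exponent [p^-1], then raise to
    the power [p]. *)
Lemma powR_ge_bernoulli x p : 0 <= x -> 1 <= p -> 1 + p * (x - 1) <= x `^ p.
Proof.
move=> x0 p1; have p0 : 0 < p by lra.
have [m0|m0] := lerP (1 + p * (x - 1)) 0.
  by apply: le_trans m0 _; exact: powR_ge0.
have := @powR_le_bernoulli (1 + p * (x - 1)) p^-1 (ltW m0).
rewrite invr_gt0 invf_le1 // => /(_ p0 p1).
have -> : 1 + p^-1 * (1 + p * (x - 1) - 1) = x by field; rewrite gt_eqF.
move=> /(ge0_ler_powR (ltW p0)); rewrite !nnegrE powR_ge0 x0 => /(_ isT isT).
by rewrite -powRrM mulVf ?gt_eqF // powRr1 // ltW.
Qed.

Lemma powR_ge_bernoulli_neg x p : 0 < x -> p <= 0 ->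
  1 + p * (x - 1) <= x `^ p.
Proof.
move=> x0 p0; rewrite /powR gt_eqF //.
apply: le_trans (expR_ge1Dx _); rewrite lerD2l.
by apply: ler_wnM2l => //; exact: ln_le_subr1.
Qed.

(** The tangent at [k+1] of the power function, evaluated at [k]. With Bernoulli at [k / (k+1)], it
    compares one term of a power sum with a telescoping difference. *)
Lemma powR_succ_tangent k p :
  k.+1%:R `^ p * (1 + p * (k%:R / k.+1%:R - 1)) =
  k.+1%:R `^ p - p * k.+1%:R `^ (p - 1) :> R.
Proof.
rewrite powRB ?pnatr_eq0 ?implybT // powRr1 // -natr1.
by field; rewrite natr1 pnatr_eq0.
Qed.

Lemma powR_succ_div k p :
  k.+1%:R `^ p * (k%:R / k.+1%:R) `^ p = k%:R `^ p :> R.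
Proof. by rewrite -powRM // mulrC divfK // pnatr_eq0. Qed.

Lemma powR_succ_concave k p : 0 < p -> p <= 1 ->
  p * k.+1%:R `^ (p - 1) <= k.+1%:R `^ p - k%:R `^ p :> R.
Proof.
move=> p0 p1; rewrite lerBrDl -lerBrDr -powR_succ_tangent -(powR_succ_div k).
by rewrite ler_wpM2l ?powR_ge0 // powR_le_bernoulli.
Qed.

Lemma powR_succ_convex k p : 1 <= p ->
  k.+1%:R `^ p - k%:R `^ p <= p * k.+1%:R `^ (p - 1) :> R.
Proof.
move=> p1; rewrite lerBlDr -lerBlDl -powR_succ_tangent -(powR_succ_div k p).
by rewrite ler_wpM2l ?powR_ge0 // powR_ge_bernoulli.
Qed.

(** The index 0 is excluded because the power of 0 to a negative exponent is 0 by convention, which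
    would break the inequality. *)
Lemma powR_succ_convex_neg k p : (0 < k)%N -> p <= 0 ->
  k.+1%:R `^ p - k%:R `^ p <= p * k.+1%:R `^ (p - 1) :> R.
Proof.
move=> k0 p1; rewrite lerBlDr -lerBlDl -powR_succ_tangent -(powR_succ_div k p).
by rewrite ler_wpM2l ?powR_ge0 // powR_ge_bernoulli_neg // divr_gt0 ?ltr0n.
Qed.

Lemma sum_powRN_le b m : 0 <= b -> b < 1 ->
  \sum_(0 <= k < m) k.+1%:R `^ (- b) <= m%:R `^ (1 - b) / (1 - b) :> R.
Proof.
move=> b0 b1; have b1' : 0 < 1 - b by rewrite subr_gt0.
rewrite ler_pdivlMr //; elim: m => [|m IH].
  by rewrite big_nil mul0r powR_ge0.
rewrite big_nat_recr //= mulrDl.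
have := @powR_succ_concave m (1 - b) b1'; rewrite addrAC subrr add0r gerBl => /(_ b0).
lra.
Qed.

Lemma sum_powRN_gt1_le b m : 1 < b ->
  \sum_(0 <= k < m.+1) k.+1%:R `^ (- b) <= b / (b - 1) :> R.
Proof.
move=> b1; have b1' : 0 < b - 1 by rewrite subr_gt0.
(* Keeping the negative power makes the induction telescope; for [m = 0] both sides equal
   [b - 1]. *)
suff h : (\sum_(0 <= k < m.+1) k.+1%:R `^ (- b)) * (b - 1)
    <= b - m.+1%:R `^ (1 - b) :> R.
  rewrite ler_pdivlMr //; apply: le_trans h _.
  by rewrite gerBl powR_ge0.
elim: m => [|m IH].
  by rewrite big_nat1 powR1; lra.
rewrite big_nat_recr //= mulrDl.
have := @powR_succ_convex_neg m.+1 (1 - b) isT.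
rewrite addrAC subrr add0r subr_le0 => /(_ (ltW b1)); lra.
Qed.

Lemma sum_powR_ge a m : 0 <= a ->
  m%:R `^ (1 + a) / (1 + a) <= \sum_(0 <= k < m) k.+1%:R `^ a :> R.
Proof.
move=> a0; have a1 : 0 < 1 + a by lra.
rewrite ler_pdivrMr //; elim: m => [|m IH].
  by rewrite big_nil mul0r powR0 // gt_eqF.
rewrite big_nat_recr //= mulrDl.
have := @powR_succ_convex m (1 + a); rewrite addrAC subrr add0r lerDl => /(_ a0).
lra.
Qed.

Lemma invr_succ_le_ln k : (0 < k)%N ->
  k.+1%:R^-1 <= ln k.+1%:R - ln k%:R :> R.
Proof.
move=> k0; have kR : 0 < k%:R :> R by rewrite ltr0n.
have := ln_le_subr1 (divr_gt0 kR (ltr0Sn R k)).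
rewrite ln_div ?posrE //.
suff -> : k%:R / k.+1%:R - 1 = - k.+1%:R^-1 :> R.
  by rewrite lerNr opprB.
by rewrite -natr1; field; rewrite natr1 pnatr_eq0.
Qed.

Lemma sum_invr_le_ln s m : (0 < s <= m)%N ->
  \sum_(s <= k < m) k.+1%:R^-1 <= ln m%:R - ln s%:R :> R.
Proof.
case/andP => s0; elim: m => [|m IH]; first by rewrite leqNgt s0.
rewrite leq_eqVlt => /orP[/eqP <-|]; first by rewrite big_geq // subrr.
rewrite ltnS => sm; rewrite big_nat_recr //=.
apply: le_trans (lerD (IH sm) (invr_succ_le_ln (leq_trans s0 sm))) _.
by rewrite addrC addrA subrK.
Qed.

Lemma harmonic_le_ln m :
  \sum_(0 <= k < m.+1) k.+1%:R^-1 <= 1 + ln m.+1%:R :> R.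
Proof.
rewrite big_ltn // invr1 lerD2l.
by have := @sum_invr_le_ln 1 m.+1 isT; rewrite ln1 subr0.
Qed.

Lemma ln4_ge1 : 1 <= ln 4 :> R.
Proof.
have h : ln (2^-1) <= 2^-1 - 1 :> R by exact: ln_le_subr1.
rewrite lnV ?posrE // in h.
have -> : 4 = 2 ^+ 2 :> R by rewrite expr2 -natrM.
by rewrite lnXn // mulr2n; lra.
Qed.

(** For a positive upper index, the first term is at most [1/2], hence at most [ln 2]; the others
    sum to at most the logarithm of a ratio not exceeding 2. Together this gives [2 ln 2]. *)
Lemma half_harmonic_le_ln4 T :
  \sum_(uphalf T <= k < T.+1) k.+1%:R^-1 <= ln 4 :> R.
Proof.
case: T => [|T]; first by rewrite big_nat1 invr1 ln4_ge1.
set s := uphalf _.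
have [s_gt0 s_leT T_les] :
    [/\ (0 < s)%N, (s <= T.+1)%N & (T.+1 <= s.*2)%N].
  have := odd_double_half T.+1; rewrite /s uphalf_half.
  by case: odd => h; split; lia.
rewrite big_ltn //.
have h1 : \sum_(s.+1 <= k < T.+2) k.+1%:R^-1 <= ln T.+2%:R - ln s.+1%:R :> R.
  by apply: sum_invr_le_ln.
have h2 : ln T.+2%:R <= ln 2 + ln s.+1%:R :> R.
  by rewrite -lnM ?posrE // ler_ln ?posrE ?mulr_gt0 // -natrM ler_nat; lia.
have h3 : s.+1%:R^-1 <= 2^-1 :> R by rewrite lef_pV2 ?posrE // ler_nat.
have h4 : ln 4 = ln 2 *+ 2 :> R.
  by rewrite -lnXn // expr2 -natrM.
move: ln4_ge1 h1 h2 h3; rewrite h4 mulr2n.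
move: (ln T.+2%:R) (ln s.+1%:R) (s.+1%:R^-1) (\sum_(s.+1 <= k < _) _) => A B C E.
lra.
Qed.

End PowerSums.

(** * First-order optimality of a proximal step *)

Section FirstOrder.
Variables (R : realType) (n : nat) (X : set 'rV[R]_n).
Variables (psi : 'rV[R]_n -> R) (g : 'rV[R]_n -> 'rV[R]_n).
Hypothesis X_convex : convex_set X.
Hypothesis psi_grad : is_gradient_on X psi g.

Lemma convex_set_segment (p w : 'rV[R]_n) (s : R) :
  X p -> X w -> 0 <= s -> s <= 1 -> X (p + s *: (w - p)).
Proof.
move=> Xp Xw s0 s1.
have /set_mem := X_convex (Itv01 s0 s1) (mem_set Xw) (mem_set Xp).
suff -> : conv (Itv01 s0 s1) (w : convex_lmodType 'rV[R]_n) p = p + s *: (w - p) by [].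
rewrite [LHS]/(s *: w + (1 - s) *: p) scalerBl scale1r scalerBr.
by rewrite addrCA.
Qed.

(** The gradient is only relative to [X], so [p] is perturbed along the segment towards [w], which
    stays in [X]. Minimality and the little-o expansion are then divided by the step [s]. *)
Lemma argmin_first_order (zeta p w : 'rV[R]_n) :
  is_argmin X (fun z => dotp zeta z + psi z) p -> X w ->
  0 <= dotp (zeta + g p) (w - p).
Proof.
move=> [Xp pmin] Xw; set A := dotp _ _; set d := `|w - p|.
have d1 : 0 < d + 1 by rewrite ltr_wpDl ?normr_ge0.
suff h : forall e : R, 0 < e -> 0 <= A + e * d.
  rewrite leNgt; apply/negP => A0.
  have e0 : 0 < - A / (d + 1) by rewrite divr_gt0 // oppr_gt0.
  have := h _ e0.
  have -> : A + - A / (d + 1) * d = - (- A / (d + 1)) by field; rewrite gt_eqF.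
  by rewrite oppr_ge0 leNgt e0.
move=> e e0; have /eqoP /(_ e e0) := psi_grad Xp.
rewrite /within /= => /(@nbhs_normP R 'rV[R]_n p) [r /= r0 hr].
(* Small enough to stay on the segment and in the ball of radius [r]; [d + 1] avoids dividing by 0
   when [w = p]. *)
pose s := Num.min 1 (r / (d + 1)).
have s0 : 0 < s by rewrite lt_min ltr01 divr_gt0.
have s1 : s <= 1 by rewrite ge_min lexx.
have Xz := convex_set_segment Xp Xw (ltW s0) s1.
have sd : s * d < r.
  have : s <= r / (d + 1) by rewrite ge_min lexx orbT.
  rewrite ler_pdivlMr // mulrDr mulr1 => h; apply: lt_le_trans h; lra.
have dp : p + s *: (w - p) - p = s *: (w - p) by rewrite addrAC subrr add0r.
have := hr (p + s *: (w - p)).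
rewrite /= distrC dp normrZ gtr0_norm // => /(_ sd Xz) h2.
have {}h2 : psi (p + s *: (w - p)) - psi p - dotp (g p) (s *: (w - p)) <= e * (s * d).
  exact: le_trans (ler_norm _) h2.
have := pmin _ Xz; rewrite dotpDr !dotpZr in h2 * => h3.
rewrite -(pmulr_rge0 _ s0) mulrDr /A dotpDl.
lra.
Qed.

(** The right side equals [<g p - g x, z - p>] by the three-point identity. *)
Lemma bregman_argmin_le (zeta x p z : 'rV[R]_n) :
  is_argmin X (fun z => dotp (zeta - g x) z + psi z) p -> X z ->
  dotp zeta (p - z) <=
  bregman psi g z x - bregman psi g z p - bregman psi g p x.
Proof.
move=> pmin Xz; have := argmin_first_order pmin Xz.
rewrite /bregman !(dotpBl, dotpBr, dotpDl); lra.
Qed.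

End FirstOrder.

(** * One iteration of the algorithm *)

Section Popov.
Variables (R : realType) (n : nat) (N : 'rV[R]_n -> R) (X : set 'rV[R]_n).
Variables (F : 'rV[R]_n -> 'rV[R]_n) (psi : 'rV[R]_n -> R).
Variables (g : 'rV[R]_n -> 'rV[R]_n) (alpha nu L M D : R).
Hypothesis N_norm : is_norm N.
Hypothesis alpha_gt0 : 0 < alpha.
Hypothesis psi_convex : strongly_convex_on X N psi g alpha.
Local Notation B := (bregman psi g).

Lemma bregman_ge_norm z x : X x -> X z -> alpha / 2 * N (z - x) ^+ 2 <= B z x.
Proof. by move=> Xx Xz; have := psi_convex Xx Xz; rewrite /bregman; lra. Qed.

Lemma bregman_ge0 z x : X x -> X z -> 0 <= B z x.
Proof.
move=> Xx Xz; apply: le_trans (bregman_ge_norm Xx Xz).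
by rewrite mulr_ge0 ?sqr_ge0 // divr_ge0 // ltW.
Qed.

(** Split [<F y1, y1 - z>] into [<F y1, x1 - z>], [<F y0, y1 - x1>] and [<F y1 - F y0, y1 - x1>].
    The first two are bounded by optimality of [x1] and [y1], the last by duality of norms. *)
Lemma popov_step (gam K : R) (x0 x1 y0 y1 z : 'rV[R]_n) :
  convex_set X -> is_gradient_on X psi g -> 0 < gam ->
  conj_norm N (F y1 - F y0) <= K -> X x0 -> X z ->
  is_argmin X (fun z => dotp (gam *: F y0 - g x0) z + psi z) y1 ->
  is_argmin X (fun z => dotp (gam *: F y1 - g x0) z + psi z) x1 ->
  gam * dotp (F y1) (y1 - z) <= B z x0 - B z x1 + gam ^+ 2 * (K ^+ 2 / (2 * alpha)).
Proof.
move=> Xc psig gam0 FK Xx0 Xz y1min x1min.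
have [Xy1 _] := y1min; have [Xx1 _] := x1min.
have h1 := bregman_argmin_le Xc psig x1min Xz.
have h2 := bregman_argmin_le Xc psig y1min Xx1.
have h3 := bregman_ge_norm Xy1 Xx1.
have h4 := bregman_ge0 Xx0 Xy1.
set m := N (x1 - y1) in h3.
have m0 : 0 <= m := is_norm_ge0 N_norm _.
have h5 : dotp (F y1 - F y0) (y1 - x1) <= K * m.
  apply: le_trans (dotp_le_conj_norm N_norm _ _) _.
  by rewrite (is_norm_distC N_norm) -/m ler_wpM2r.
have {}h5 := ler_wpM2l (ltW gam0) h5.
(* AM-GM absorbs the cross term into the strong convexity of [psi]. *)
have h6 : gam * (K * m) <= alpha / 2 * m ^+ 2 + gam ^+ 2 * (K ^+ 2 / (2 * alpha)).
  rewrite -subr_ge0.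
  have -> : alpha / 2 * m ^+ 2 + gam ^+ 2 * (K ^+ 2 / (2 * alpha)) - gam * (K * m)
    = (alpha * m - gam * K) ^+ 2 / (2 * alpha) by field; rewrite gt_eqF.
  by rewrite divr_ge0 ?sqr_ge0 // mulr_ge0 // ltW.
rewrite !(dotpZl, dotpBl, dotpBr) in h1 h2 h5 *.
lra.
Qed.

Lemma Dbar_ge0 : 0 <= Dbar nu L M alpha D.
Proof.
rewrite /Dbar; case: eqP => _.
  by rewrite divr_ge0 ?sqr_ge0 // mulr_ge0 // ltW.
apply: addr_ge0.
  apply: divr_ge0 (powR_ge0 _ _); apply: mulr_ge0 (powR_ge0 _ _).
  by apply: mulr_ge0 (sqr_ge0 _); apply: mulr_ge0 (powR_ge0 _ _).
by apply: divr_ge0 (ltW alpha_gt0); apply: mulr_ge0 (sqr_ge0 _).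
Qed.

(** Strong convexity and [D] give [N (x - y) ^+ 2 <= 2 * D / alpha]. For [nu > 0] the square is then
    split by [(a + b)^2 <= 2 a^2 + 2 b^2]; for [nu = 0] both sides coincide. *)
Lemma growth_sqr_le_Dbar (x y : 'rV[R]_n) :
  0 <= nu -> 0 < L -> 0 <= M -> 0 < D ->
  (forall x z, X x -> X z -> B z x <= D) -> X x -> X y ->
  (L * N (x - y) `^ nu + M) ^+ 2 / (2 * alpha) <= Dbar nu L M alpha D.
Proof.
move=> nu0 L0 M0 D0 BD Xx Xy; rewrite /Dbar.
have [->|nu_neq0] := eqVneq nu 0; first by rewrite powRr0 mulr1.
set m := N _; set P := m `^ nu.
have m0 : 0 <= m := is_norm_ge0 N_norm _.
have hm : m ^+ 2 <= 2 * D / alpha.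
  rewrite ler_pdivlMr //.
  by have := le_trans (bregman_ge_norm Xy Xx) (BD _ _ Xy Xx); rewrite -/m; lra.
have hP : P ^+ 2 <= 2 `^ nu * D `^ nu / alpha `^ nu.
  have -> : P ^+ 2 = (m ^+ 2) `^ nu.
    by rewrite -!powR_mulrn ?powR_ge0 // powRAC.
  have -> : 2 `^ nu * D `^ nu / alpha `^ nu = (2 * D / alpha) `^ nu.
    have D20 : 0 <= 2 * D by rewrite mulr_ge0 // ltW.
    rewrite powRM ?invr_ge0 // ?(ltW alpha_gt0) // powRM // ?ltW //.
    by rewrite -[alpha^-1]powR_inv1 ?ltW // powRAC powR_inv1 // powR_ge0.
  by rewrite ge0_ler_powR // nnegrE ?sqr_ge0 // divr_ge0 ?mulr_ge0 // ltW.
rewrite powRD; last by rewrite (gt_eqF alpha_gt0) implybT.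
rewrite powRr1 ?(ltW alpha_gt0) //.
set Q := 2 `^ nu * _ / _ in hP.
have Q0 : 0 <= Q by apply: le_trans hP; exact: sqr_ge0.
have a0 : 0 < alpha `^ nu by exact: powR_gt0.
have -> : 3 * 2 `^ nu * L ^+ 2 * D `^ nu / (alpha * alpha `^ nu) + 6 * M ^+ 2 / alpha
   = (6 * (L ^+ 2 * Q) + 12 * M ^+ 2) / (2 * alpha).
  by rewrite /Q; field; rewrite !gt_eqF.
rewrite ler_pM2r ?invr_gt0 ?mulr_gt0 //.
have h : L ^+ 2 * P ^+ 2 <= L ^+ 2 * Q by rewrite ler_wpM2l ?sqr_ge0.
have h1 : 0 <= L ^+ 2 * Q by rewrite mulr_ge0 ?sqr_ge0.
have h2 := sqr_ge0 (L * P - M); have h3 := sqr_ge0 M.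
rewrite !expr2 in h h1 h2 h3 *; nra.
Qed.

End Popov.

(** * Summation by parts and the gap at weighted averages *)

Lemma abel_sum_le (R : realDomainType) (r b : nat -> R) (D : R) (s m : nat) :
  (forall t, 0 <= r t) -> {homo r : i j / (i <= j)%N >-> i <= j} ->
  (forall t, 0 <= b t) -> (forall t, b t <= D) -> (s <= m)%N ->
  \sum_(s <= t < m.+1) r t * (b t - b t.+1) <= r m * D.
Proof.
move=> r0 r_mono b0 bD sm.
(* The extra term carries the induction: as [b m.+1 <= D], the weight [r m] may be raised to
   [r m.+1]. *)
suff : \sum_(s <= t < m.+1) r t * (b t - b t.+1) <= r m * (D - b m.+1).
  by move/le_trans; apply; rewrite ler_wpM2l // gerBl.
elim: m sm => [|m IH].
  by rewrite leqn0 => /eqP ->; rewrite big_nat1 ler_wpM2l // lerB.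
rewrite leq_eqVlt => /orP[/eqP ->|]; first by rewrite big_nat1 ler_wpM2l // lerB.
rewrite ltnS => sm; rewrite big_nat_recr ?leqW //=.
apply: le_trans (lerD (IH sm) (lexx _)) _.
have : r m * (D - b m.+1) <= r m.+1 * (D - b m.+1).
  by rewrite ler_wpM2r ?subr_ge0 // r_mono.
lra.
Qed.

Section Gap.
Variables (R : realType) (n : nat) (N : 'rV[R]_n -> R) (X : set 'rV[R]_n).
Variables (F : 'rV[R]_n -> 'rV[R]_n) (psi : 'rV[R]_n -> R).
Variables (g : 'rV[R]_n -> 'rV[R]_n) (alpha nu L M D : R).
Hypothesis N_norm : is_norm N.
Hypothesis X_convex : convex_set X.
Hypothesis alpha_gt0 : 0 < alpha.
Hypothesis psi_grad : is_gradient_on X psi g.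
Hypothesis psi_convex : strongly_convex_on X N psi g alpha.
Hypothesis F_monotone : monotone_on X F.
Hypotheses (nu_ge0 : 0 <= nu) (L_gt0 : 0 < L) (M_ge0 : 0 <= M).
Hypothesis F_growth : growth_condition X N F nu L M.
Hypothesis D_gt0 : 0 < D.
Hypothesis D_max : forall x z, X x -> X z -> bregman psi g z x <= D.
Variables (gamma : nat -> R) (x y : nat -> 'rV[R]_n).
Hypothesis xy_popov : popov_mirror_prox X F psi g gamma x y.
Local Notation B := (bregman psi g).
Local Notation DD := (Dbar nu L M alpha D).

Lemma popov_in t : X (x t) /\ X (y t).
Proof.
by case: xy_popov => Xx0 y0 h; case: t => [|t]; [rewrite y0 | case: (h t) => _ [? _] []].
Qed.

(** Monotonicity replaces [F y_{t+1}] by [F z], the operator value in the dual gap. *)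
Lemma popov_step_Dbar t z : X z ->
  gamma t * dotp (F z) (y t.+1 - z) <= B z (x t) - B z (x t.+1) + gamma t ^+ 2 * DD.
Proof.
move=> Xz; have [_ _ /(_ t) [gam0 ymin xmin]] := xy_popov.
have [Xx Xy] := popov_in t; have [Xx1 Xy1] := popov_in t.+1.
have := popov_step N_norm alpha_gt0 psi_convex X_convex psi_grad gam0
  (F_growth Xy1 Xy) Xx Xz ymin xmin.
have := growth_sqr_le_Dbar N_norm alpha_gt0 psi_convex nu_ge0 L_gt0 M_ge0 D_gt0
  D_max Xy1 Xy.
move=> /(ler_wpM2l (sqr_ge0 (gamma t))).
have := F_monotone Xy1 Xz; rewrite dotpBl => /(mulr_ge0 (ltW gam0)).
lra.
Qed.

Lemma weighted_gap_le (r w : nat -> R) (s T : nat) (C : R) :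
  (forall t, 0 < r t) -> {homo r : i j / (i <= j)%N >-> i <= j} ->
  (s <= T)%N -> (forall t, (t <= T)%N -> w t = r t * gamma t) ->
  r T * D + DD * \sum_(s <= t < T.+1) r t * gamma t ^+ 2
    <= C * \sum_(s <= t < T.+1) w t ->
  (dual_gap X F ((\sum_(s <= t < T.+1) w t)^-1
      *: \sum_(s <= t < T.+1) w t *: y t.+1) <= C%:E)%E.
Proof.
move=> r0 r_mono sT wE; set W := \sum_(_ <= _ < _) w _ => hC.
have gam0 t : 0 < gamma t by have [_ _ /(_ t) []] := xy_popov.
have W0 : 0 < W.
  rewrite /W big_nat_recr //= ltr_wpDl //; last by rewrite wE // mulr_gt0.
  rewrite big_nat_cond; apply: sumr_ge0 => t /andP[/andP[_ tT] _].
  by rewrite wE 1?ltnW // mulr_ge0 ?(ltW (r0 _)) ?(ltW (gam0 _)).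
apply: ge_ereal_sup => _ [z Xz <-]; rewrite lee_fin.
rewrite -(ler_pM2r W0); apply: le_trans hC.
have -> : dotp (F z) (W^-1 *: \sum_(s <= t < T.+1) w t *: y t.+1 - z) * W =
    \sum_(s <= t < T.+1) r t * (gamma t * dotp (F z) (y t.+1 - z)).
  rewrite dotpBr dotpZr dotp_sumr mulrBl mulrAC mulVf ?gt_eqF // mul1r.
  rewrite mulr_sumr -sumrB big_nat [RHS]big_nat; apply: eq_bigr => t /andP[_ tT].
  by rewrite dotpZr dotpBr wE // mulrA mulrBr [X in _ - X]mulrC.
have -> : r T * D + DD * \sum_(s <= t < T.+1) r t * gamma t ^+ 2 =
  r T * D + \sum_(s <= t < T.+1) r t * (gamma t ^+ 2 * DD).
  by rewrite mulr_sumr; congr (_ + _); apply: eq_bigr => t _; rewrite mulrC mulrA.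
have := @abel_sum_le _ r (fun t => B z (x t)) D s T (fun t => ltW (r0 t)) r_mono
   (fun t => bregman_ge0 alpha_gt0 psi_convex (popov_in t).1 Xz)
   (fun t => D_max (popov_in t).1 Xz) sT.
move=> h; apply: le_trans (lerD h (lexx _)); rewrite -big_split.
by apply: ler_sum => t _; rewrite /= -mulrDr ler_wpM2l ?(ltW (r0 t)) // popov_step_Dbar.
Qed.

End Gap.

(** * The rates for each choice of steps and weights *)

Theorem corollary1 (R : realType) (n : nat) (N : 'rV[R]_n -> R)
    (X : set 'rV[R]_n) (F : 'rV[R]_n -> 'rV[R]_n)
    (psi : 'rV[R]_n -> R) (gradpsi : 'rV[R]_n -> 'rV[R]_n)
    (alpha nu L M D : R)
    (N_norm : is_norm N)
    (X_neq0 : X !=set0) (X_closed : closed X) (X_convex : convex_set X)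
    (X_bounded : bounded_set X)
    (alpha_gt0 : 0 < alpha) (psi_C1 : C1_on X psi gradpsi)
    (psi_convex : strongly_convex_on X N psi gradpsi alpha)
    (F_monotone : monotone_on X F)
    (nu_ge0 : 0 <= nu) (L_gt0 : 0 < L) (M_ge0 : 0 <= M)
    (F_growth : growth_condition X N F nu L M)
    (D_gt0 : 0 < D)
    (D_max : forall x z, X x -> X z -> bregman psi gradpsi z x <= D)
    (gamma : nat -> R) (x y : nat -> 'rV[R]_n)
    (xy_popov : popov_mirror_prox X F psi gradpsi gamma x y) :
  let DD := Dbar nu L M alpha D in
  (forall (T : nat) (c : R), 0 < c ->
    ((forall t : nat, (t <= T)%N -> gamma t = c / Num.sqrt T.+1%:R) ->
      (dual_gap X F (T.+1%:R^-1 *: \sum_(0 <= t < T.+1) y t.+1)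
        <= ((D + c ^+ 2 * DD) / (c * Num.sqrt T.+1%:R))%:E)%E)
    /\
    ((forall t : nat, (t <= T)%N -> gamma t = c / Num.sqrt t.+1%:R) ->
      (dual_gap X F
         ((\sum_(uphalf T <= t < T.+1) gamma t)^-1
            *: \sum_(uphalf T <= t < T.+1) gamma t *: y t.+1)
        <= ((2 * D + 2 * ln 4 * c ^+ 2 * DD)
              / (c * Num.sqrt T.+1%:R))%:E)%E))
  /\
  (forall c a : R, 0 < c -> 0 < a -> a < 1 ->
    (forall t : nat, gamma t = c / t.+1%:R `^ a) ->
    forall T : nat,
    let G := dual_gap X F
      ((\sum_(0 <= t < T.+1) gamma t)^-1
         *: \sum_(0 <= t < T.+1) gamma t *: y t.+1) in
    [/\ a < 2^-1 ->
        (G <= (D / (c * T.+1%:R `^ (1 - a))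
               + DD * c / ((1 - 2 * a) * T.+1%:R `^ a))%:E)%E,
        a = 2^-1 ->
        (G <= (D / (c * T.+1%:R `^ (1 - a))
               + DD * c * (1 + ln T.+1%:R) / T.+1%:R `^ (1 - a))%:E)%E &
        2^-1 < a ->
        (G <= (D / (c * T.+1%:R `^ (1 - a))
               + 2 * a * DD * c
                   / ((2 * a - 1) * T.+1%:R `^ (1 - a)))%:E)%E])
  /\
  (forall c a : R, 0 < c -> 0 < a -> a < 1 ->
    (forall t : nat, gamma t = c / t.+1%:R `^ a) ->
    forall T : nat, (1 <= T)%N ->
    (dual_gap X F
       ((\sum_(0 <= t < T.+1) (gamma t)^-1)^-1
          *: \sum_(0 <= t < T.+1) (gamma t)^-1 *: y t.+1)
      <= (4 `^ a * (1 + a) * D / (c * T%:R `^ (1 - a))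
          + 2 * DD * c * (1 + a) / T%:R `^ a)%:E)%E).
Proof.
have gap_le := weighted_gap_le N_norm X_convex alpha_gt0 psi_C1.1 psi_convex
  F_monotone nu_ge0 L_gt0 M_ge0 F_growth D_gt0 D_max xy_popov.
move=> DD; have DD0 : 0 <= DD by exact: Dbar_ge0.
have gam0 t : 0 < gamma t by have [_ _ /(_ t) []] := xy_popov.
split; [move=> T c c0; split=> gammaE | split=> c a c0 a0 a1 gammaE T].
- set S := Num.sqrt _ in gammaE *; have S0 : 0 < S by rewrite sqrtr_gt0 ltr0n.
  have SS : S ^+ 2 = T.+1%:R by rewrite sqr_sqrtr.
  have sum1 : \sum_(0 <= t < T.+1) (1 : R) = S ^+ 2.
    by rewrite sumr_const_nat subn0 SS.
  (* [S / c] is the inverse step, so the averaging weights are all 1. *)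
  have := gap_le (fun=> S / c) (fun=> 1) 0%N T ((D + c ^+ 2 * DD) / (c * S)).
  rewrite sum1 SS; under [in X in dual_gap _ _ (_ *: X)]eq_bigr do rewrite scale1r.
  apply => //; [by move=> _; exact: divr_gt0 | |].
    by move=> t tT; rewrite gammaE //; field; rewrite !gt_eqF.
  rewrite -SS (_ : \sum_(0 <= t < T.+1) _ = S * c); last first.
    rewrite -[RHS](_ : \sum_(0 <= t < T.+1) c / S = _).
      by apply: eq_big_nat => t /andP[_ tT]; rewrite gammaE //; field; rewrite !gt_eqF.
    by rewrite sumr_const_nat subn0 -mulr_natl -SS; field; rewrite gt_eqF.
  by rewrite -/DD le_eqVlt; apply/orP; left; apply/eqP; field; rewrite !gt_eqF.
- set S := Num.sqrt T.+1%:R; have S0 : 0 < S by rewrite sqrtr_gt0 ltr0n.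
  have SS : S ^+ 2 = T.+1%:R by rewrite sqr_sqrtr.
  have sT : (uphalf T <= T)%N by rewrite leq_uphalf_double; lia.
  apply: (gap_le (fun=> 1)) => //; first by move=> t _; rewrite mul1r.
  have sum_sqr : \sum_(uphalf T <= t < T.+1) 1 * gamma t ^+ 2 <= c ^+ 2 * ln 4.
    apply: (@le_trans _ _ (c ^+ 2 * \sum_(uphalf T <= t < T.+1) t.+1%:R^-1)).
      rewrite mulr_sumr le_eqVlt; apply/orP; left; apply/eqP.
      apply: eq_big_nat => t /andP[_ tT].
      by rewrite gammaE // mul1r expr_div_n sqr_sqrtr.
    by rewrite ler_wpM2l ?sqr_ge0 // half_harmonic_le_ln4.
  (* The window holds at least [(T+1)/2] indices, and each step in it is at least the last one,
     [c / S]. *)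
  have sum_gam : c * S / 2 <= \sum_(uphalf T <= t < T.+1) gamma t.
    apply: (@le_trans _ _ (\sum_(uphalf T <= t < T.+1) c / S)).
      rewrite sumr_const_nat -[leRHS]mulr_natl.
      have h : S ^+ 2 / 2 <= (T.+1 - uphalf T)%:R.
        rewrite SS ler_pdivrMr // -natrM ler_nat.
        by have := odd_double_half T; rewrite uphalf_half; case: odd => h; lia.
      have -> : c * S / 2 = S ^+ 2 / 2 * (c / S) by field; rewrite gt_eqF.
      by rewrite ler_wpM2r // divr_ge0 // ltW.
    apply: ler_sum_nat => t /andP[_ tT]; rewrite gammaE //.
    rewrite ler_wpM2l ?(ltW c0) // lef_pV2 ?posrE ?sqrtr_gt0 ?ltr0n //.
    by rewrite ler_sqrt ?ler_nat.
  have C0 : 0 <= (2 * D + 2 * ln 4 * c ^+ 2 * DD) / (c * S).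
    apply: divr_ge0; last by rewrite mulr_ge0 // ltW.
    have l4 : 0 <= ln 4 :> R := le_trans ler01 (ln4_ge1 R).
    by rewrite addr_ge0 // !mulr_ge0 ?sqr_ge0 // ltW.
  apply: le_trans (ler_wpM2l C0 sum_gam).
  have -> : (2 * D + 2 * ln 4 * c ^+ 2 * DD) / (c * S) * (c * S / 2)
    = D + DD * (c ^+ 2 * ln 4) by field; rewrite !gt_eqF.
  by rewrite mul1r lerD2l -/DD ler_wpM2l.
- set n1 : R := T.+1%:R; have n0 : 0 < n1 by rewrite ltr0n.
  set P := n1 `^ (1 - a); have P0 : 0 < P by exact: powR_gt0.
  pose Sg : R := \sum_(0 <= t < T.+1) t.+1%:R `^ (- (2 * a)).
  have Sg0 : 0 <= Sg by apply: sumr_ge0 => t _; exact: powR_ge0.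
  set G := dual_gap _ _ _.
  (* The three ranges of [a] differ only in the bound on [Sg]. The total weight is at least [T+1]
     times the smallest step, that is [c * P]. *)
  have GS : (G <= (D / (c * P) + DD * c * Sg / P)%:E)%E.
    apply: (gap_le (fun=> 1)) => //; first by move=> t _; rewrite mul1r.
    have -> : \sum_(0 <= t < T.+1) 1 * gamma t ^+ 2 = c ^+ 2 * Sg.
      rewrite mulr_sumr; apply: eq_bigr => t _.
      rewrite mul1r gammaE expr_div_n -[_ ^+ 2 in X in _ / X]powR_mulrn ?powR_ge0 //.
      by rewrite -powRrM powRN mulrC [a * _]mulrC mulrC.
    have sum_gam : c * P <= \sum_(0 <= t < T.+1) gamma t.
      apply: (@le_trans _ _ (\sum_(0 <= t < T.+1) c / n1 `^ a)).
        rewrite sumr_const_nat subn0 -[leRHS]mulr_natl -/n1 /P.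
        rewrite powRB ?(gt_eqF n0) ?implybT // powRr1 ?(ltW n0) //.
        by rewrite mulrCA.
      apply: ler_sum_nat => t /andP[_ tT]; rewrite gammaE.
      rewrite ler_wpM2l ?(ltW c0) // lef_pV2 ?posrE ?powR_gt0 ?ltr0n //.
      by rewrite ge0_ler_powR ?(ltW a0) // ?nnegrE ?ler_nat.
    have C0 : 0 <= D / (c * P) + DD * c * Sg / P.
      apply: addr_ge0; first by rewrite divr_ge0 ?mulr_ge0 ?(ltW D_gt0) // ltW.
      by rewrite divr_ge0 ?(ltW P0) // !mulr_ge0 // ltW.
    apply: le_trans (ler_wpM2l C0 sum_gam).
    by rewrite -/DD le_eqVlt; apply/orP; left; apply/eqP; field; rewrite !gt_eqF.
  have GS' (S : R) : Sg <= S -> (G <= (D / (c * P) + DD * c * S / P)%:E)%E.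
    move=> SgS; apply: le_trans GS _; rewrite lee_fin lerD2l.
    by rewrite ler_wpM2r ?invr_ge0 ?(ltW P0) // ler_wpM2l // mulr_ge0 // ltW.
  split=> ha.
  + have -> : DD * c / ((1 - 2 * a) * n1 `^ a)
        = DD * c * (n1 `^ (1 - 2 * a) / (1 - 2 * a)) / P.
      have -> : n1 `^ (1 - 2 * a) = P / n1 `^ a.
        rewrite /P -powRB ?(gt_eqF n0) ?implybT //; congr (_ `^ _); ring.
      by field; rewrite !gt_eqF ?powR_gt0 //; lra.
    by apply: GS'; apply: sum_powRN_le; lra.
  + apply: GS'; rewrite /Sg ha mulfV ?pnatr_eq0 //.
    apply: le_trans (harmonic_le_ln R T).
    by apply: ler_sum => t _; rewrite powR_inv1.
  + have -> : 2 * a * DD * c / ((2 * a - 1) * P) = DD * c * (2 * a / (2 * a - 1)) / P.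
      by field; rewrite !gt_eqF //; lra.
    by apply: GS'; apply: sum_powRN_gt1_le; lra.
- move=> T1; set n1 : R := T.+1%:R; have n0 : 0 < n1 by rewrite ltr0n.
  set Q := n1 `^ a; have Q0 : 0 < Q by exact: powR_gt0.
  have a10 : 0 < 1 + a by lra.
  have n1a (p : R) : n1 `^ (1 + p) = n1 * n1 `^ p.
    by rewrite powRD ?(gt_eqF n0) ?implybT // powRr1 // ltW.
  have hn : n1 `^ (1 - a) = n1 / Q by rewrite n1a powRN.
  (* A sharper bound, in powers of [T+1] and with smaller constants. With [r_t = gamma_t^-2] each
     product [r_t gamma_t^2] is 1, so the error sum is just [T+1]. *)
  have GS : (dual_gap X F ((\sum_(0 <= t < T.+1) (gamma t)^-1)^-1
          *: \sum_(0 <= t < T.+1) (gamma t)^-1 *: y t.+1)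
     <= ((1 + a) * D / (c * n1 `^ (1 - a)) + DD * c * (1 + a) / Q)%:E)%E.
    apply: (gap_le (fun t => (gamma t)^-1 ^+ 2)) => //.
    + by move=> t; rewrite exprn_gt0 ?invr_gt0.
    + move=> i j ij; rewrite lerXn2r ?nnegrE ?invr_ge0 ?(ltW (gam0 _)) //.
      rewrite lef_pV2 ?posrE // !gammaE ler_wpM2l ?(ltW c0) //.
      rewrite lef_pV2 ?posrE ?powR_gt0 ?ltr0n //.
      by rewrite ge0_ler_powR ?(ltW a0) // ?nnegrE ?ler_nat.
    + by move=> t _; field; rewrite gt_eqF.
    have -> : \sum_(0 <= t < T.+1) (gamma t)^-1 ^+ 2 * gamma t ^+ 2 = n1.
      rewrite (eq_bigr (fun=> 1)) ?sumr_const_nat ?subn0 // => t _.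
      by rewrite -exprMn mulVf ?expr1n // gt_eqF.
    have sum_w : n1 * Q / (c * (1 + a)) <= \sum_(0 <= t < T.+1) (gamma t)^-1.
      rewrite (eq_bigr (fun t => c^-1 * t.+1%:R `^ a)); last first.
        by move=> t _; rewrite gammaE invf_div mulrC.
      rewrite -mulr_sumr invfM mulrCA ler_wpM2l ?invr_ge0 ?(ltW c0) //.
      by rewrite -n1a sum_powR_ge // ltW.
    have C0 : 0 <= (1 + a) * D / (c * n1 `^ (1 - a)) + DD * c * (1 + a) / Q.
      rewrite addr_ge0 // divr_ge0 ?(ltW Q0) // !mulr_ge0 ?powR_ge0 // ?ltW //.
    apply: le_trans (ler_wpM2l C0 sum_w).
    rewrite hn gammaE -/n1 -/Q.
    by rewrite -/DD le_eqVlt; apply/orP; left; apply/eqP; field; rewrite !gt_eqF.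
  apply: le_trans GS _; rewrite lee_fin.
  have T0 : 0 < T%:R :> R by rewrite ltr0n.
  have Tn : T%:R <= n1 by rewrite ler_nat.
  have p1 : T%:R `^ (1 - a) <= n1 `^ (1 - a).
    by rewrite ge0_ler_powR ?nnegrE ?(ltW T0) ?(ltW n0) // subr_ge0 ltW.
  have p2 : T%:R `^ a <= Q.
    by rewrite ge0_ler_powR ?nnegrE ?(ltW T0) ?(ltW n0) // ltW.
  have p1' : (c * n1 `^ (1 - a))^-1 <= (c * T%:R `^ (1 - a))^-1.
    by rewrite lef_pV2 ?posrE ?mulr_gt0 ?powR_gt0 // ler_wpM2l // ltW.
  have p2' : Q^-1 <= (T%:R `^ a)^-1.
    by rewrite lef_pV2 ?posrE ?powR_gt0.
  have four : 1 <= 4 `^ a :> R.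
    by have := @ler_powR R 4 (ler1n _ _) _ _ (ltW a0); rewrite powRr0.
  have DDc : 0 <= DD * c * (1 + a) by rewrite !mulr_ge0 // ltW.
  have Da : 0 <= (1 + a) * D by rewrite mulr_ge0 // ltW.
  apply: lerD.
    apply: ler_pM => //; first by rewrite invr_ge0 mulr_ge0 ?powR_ge0 // ltW.
    by rewrite -mulrA ler_peMl.
  apply: ler_pM => //; first by rewrite invr_ge0 ltW.
  by rewrite -!mulrA ler_peMl ?mulrA // ler1n.
Qed.
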